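(* Let $(A,\mu,\partial)$ be a GDQ ring with unit and assume there is $X\in A$ such that $\partial X=1\otimes 1$. Let $N=\operatorname{Ker}\partial$. Then the canonical homomorphism $\psi:N\langle X\rangle\to A$ is injective, and it is a GDQ ring homomorphism when $N\langle X\rangle$ is endowed with the comultiplication $\partial_{X:N}$.
   Context: A generalized difference quotient ring (GDQ ring) is a triple $(A,\mu,\partial)$ where $A$ is an algebra over $\mathbb{C}$ with multiplication map $\mu:A\otimes A\to A$, and $\partial:A\to A\otimes A$ is a linear map that is coassociative, $(\partial\otimes \mathrm{id}_A)\circ\partial=(\mathrm{id}_A\otimes\partial)\circ\partial$, and a derivation, $\partial\circ\mu=(\mathrm{id}_A\otimes\mu)\circ(\partial\otimes\mathrm{id}_A)+(\mu\otimes\mathrm{id}_A)\circ(\mathrm{id}_A\otimes\partial)$. Here $\otimes$ is the algebraic tensor product over $\mathbb{C}$. ($\operatorname{Ker}\partial$ is a unital subalgebra of $A$.) For a unital $\mathbb{C}$-algebra $N$, $N\langle X\rangle$ is the ring of noncommutative polynomials in an indeterminate $X$ with noncommutative scalars $N$ (the free product over $\mathbb{C}$ of unital algebras $N$ and $\mathbb{C}[X]$): it is spanned by the monomials $n_0Xn_1X\cdots Xn_k$, the only relations being those arising from $1X=X1=X$. The comultiplication $\partial_{X:N}:N\langle X\rangle\to N\langle X\rangle\otimes N\langle X\rangle$ is the derivation determined by $\partial_{X:N}X=1\otimes1$ and $\partial_{X:N}(N)=0$. The canonical homomorphism $\psi$ is the unital algebra homomorphism which is the inclusion on $N$ and takes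 the indeterminate $X$ to the element $X\in A$. A GDQ ring homomorphism $\psi$ between GDQ rings $(A_1,\mu_1,\partial_1)$ and $(A_2,\mu_2,\partial_2)$ is an algebra homomorphism with $(\psi\otimes\psi)\circ\partial_1=\partial_2\circ\psi$. *)

(* Defs.v *)
From HB Require Import structures.
From mathcomp Require Import all_boot all_order all_algebra.
From mathcomp Require Import boolp reals complex.

Set Implicit Arguments.
Unset Strict Implicit.
Unset Printing Implicit Defensive.

Import GRing.Theory.
Local Open Scope ring_scope.
Local Open Scope quotient_scope.

Reserved Notation "V ⊗ W" (at level 40, left associativity).

Section Tensor.
Variables (K : fieldType) (V W : lmodType K).

(* V ⊗ W is presented by generators and relations: formal K-linear           *)
(* combinations of pure tensors, modulo the smallest congruence that contains *)
(* the K-module axioms and the bilinearity of pure tensors.                   *)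
Inductive texp : Type :=
  | TPure of V & W
  | TAdd of texp & texp
  | TScale of K & texp.

Inductive teq : texp -> texp -> Prop :=
  | teq_refl x : teq x x
  | teq_sym x y : teq x y -> teq y x
  | teq_trans y x z : teq x y -> teq y z -> teq x z
  | teq_add x x' y y' : teq x x' -> teq y y' -> teq (TAdd x y) (TAdd x' y')
  | teq_scale c x x' : teq x x' -> teq (TScale c x) (TScale c x')
  | teq_addA x y z : teq (TAdd x (TAdd y z)) (TAdd (TAdd x y) z)
  | teq_addC x y : teq (TAdd x y) (TAdd y x)
  | teq_add0 x : teq (TAdd (TPure 0 0) x) x
  | teq_addN x : teq (TAdd (TScale (-1) x) x) (TPure 0 0)
  | teq_scaleA a b x : teq (TScale a (TScale b x)) (TScale (a * b) x)
  | teq_scale1 x : teq (TScale 1 x) x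
  | teq_scaleDr a x y :
      teq (TScale a (TAdd x y)) (TAdd (TScale a x) (TScale a y))
  | teq_scaleDl a b x : teq (TScale (a + b) x) (TAdd (TScale a x) (TScale b x))
  | teq_pureDl v v' w : teq (TPure (v + v') w) (TAdd (TPure v w) (TPure v' w))
  | teq_pureDr v w w' : teq (TPure v (w + w')) (TAdd (TPure v w) (TPure v w'))
  | teq_pureZl c v w : teq (TPure (c *: v) w) (TScale c (TPure v w))
  | teq_pureZr c v w : teq (TPure v (c *: w)) (TScale c (TPure v w)).

HB.instance Definition _ := gen_eqMixin texp.
HB.instance Definition _ := gen_choiceMixin texp.

Definition teqb (x y : texp) : bool := `[< teq x y >].

Lemma teqb_equiv : equiv_class_of teqb.
Proof.
split=> [x|x y|y x z].
- exact/asboolP/teq_refl.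
- by apply/asboolP/asboolP; exact: teq_sym.
- by move=> /asboolP xy /asboolP yz; apply/asboolP; exact: (teq_trans xy yz).
Qed.

Canonical teqb_equiv_rel := EquivRelPack teqb_equiv.

Definition tensor : Type := {eq_quot teqb}.
HB.instance Definition _ := Choice.on tensor.
HB.instance Definition _ := Quotient.on tensor.

Lemma tensor_eqP x y : teq x y <-> \pi_tensor x = \pi_tensor y.
Proof. by split=> [xy|/eqmodP/asboolP//]; apply/eqmodP/asboolP. Qed.

Definition tpure (v : V) (w : W) : tensor := \pi_tensor (TPure v w).
Definition tensor_add (s t : tensor) : tensor :=
  \pi_tensor (TAdd (repr s) (repr t)).
Definition tensor_scale (c : K) (t : tensor) : tensor :=
  \pi_tensor (TScale c (repr t)).

Lemma teq_repr x : teq (repr (\pi_tensor x)) x.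
Proof. by apply/tensor_eqP; rewrite reprK. Qed.

Lemma tensor_addE x y :
  tensor_add (\pi_tensor x) (\pi_tensor y) = \pi_tensor (TAdd x y).
Proof. by apply/tensor_eqP/teq_add; exact: teq_repr. Qed.

Lemma tensor_scaleE c x :
  tensor_scale c (\pi_tensor x) = \pi_tensor (TScale c x).
Proof. by apply/tensor_eqP/teq_scale; exact: teq_repr. Qed.

Lemma tensor_piP (t : tensor) : exists x, t = \pi_tensor x.
Proof. by exists (repr t); rewrite reprK. Qed.

Lemma tensor_addA : associative tensor_add.
Proof.
move=> s t u; case: (tensor_piP s) (tensor_piP t) (tensor_piP u).
move=> x -> [y ->] [z ->]; rewrite !tensor_addE.
exact/tensor_eqP/teq_addA.
Qed.

Lemma tensor_addC : commutative tensor_add.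
Proof.
move=> s t; case: (tensor_piP s) (tensor_piP t) => x -> [y ->].
by rewrite !tensor_addE; exact/tensor_eqP/teq_addC.
Qed.

Lemma tensor_add0 : left_id (tpure 0 0) tensor_add.
Proof.
move=> s; case: (tensor_piP s) => x ->.
by rewrite tensor_addE; exact/tensor_eqP/teq_add0.
Qed.

Lemma tensor_addN : left_inverse (tpure 0 0) (tensor_scale (-1)) tensor_add.
Proof.
move=> s; case: (tensor_piP s) => x ->.
by rewrite tensor_scaleE tensor_addE; exact/tensor_eqP/teq_addN.
Qed.

HB.instance Definition _ := GRing.isZmodule.Build tensor
  tensor_addA tensor_addC tensor_add0 tensor_addN.

Lemma tensor_scaleA a b t :
  tensor_scale a (tensor_scale b t) = tensor_scale (a * b) t.
Proof.
case: (tensor_piP t) => x ->; rewrite !tensor_scaleE.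
exact/tensor_eqP/teq_scaleA.
Qed.

Lemma tensor_scale1 : left_id 1 tensor_scale.
Proof.
move=> t; case: (tensor_piP t) => x ->; rewrite !tensor_scaleE.
exact/tensor_eqP/teq_scale1.
Qed.

Lemma tensor_scaleDr : right_distributive tensor_scale +%R.
Proof.
move=> a s t; case: (tensor_piP s) (tensor_piP t) => x -> [y ->].
rewrite /+%R /= tensor_addE !tensor_scaleE tensor_addE.
exact/tensor_eqP/teq_scaleDr.
Qed.

Lemma tensor_scaleDl t : {morph tensor_scale^~ t : a b / a + b}.
Proof.
move=> a b; case: (tensor_piP t) => x ->.
rewrite [RHS]/+%R /= !tensor_scaleE tensor_addE.
exact/tensor_eqP/teq_scaleDl.
Qed.

HB.instance Definition _ := GRing.Zmodule_isLmodule.Build K tensor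
  tensor_scaleA tensor_scale1 tensor_scaleDr tensor_scaleDl.

Lemma pi_tensorD x y : \pi_tensor (TAdd x y) = \pi_tensor x + \pi_tensor y.
Proof. by rewrite -tensor_addE. Qed.

Lemma pi_tensorZ c x : \pi_tensor (TScale c x) = c *: \pi_tensor x.
Proof. by rewrite -tensor_scaleE. Qed.

Lemma tpure_bilinear : bilinear_for *:%R *:%R tpure.
Proof.
split=> [w c v v'|v c w w'] /=; rewrite -pi_tensorZ -pi_tensorD.
- apply/tensor_eqP; apply: teq_trans (teq_pureDl _ _ _) _.
  by apply: teq_add (teq_refl _); exact: teq_pureZl.
- apply/tensor_eqP; apply: teq_trans (teq_pureDr _ _ _) _.
  by apply: teq_add (teq_refl _); exact: teq_pureZr.
Qed.

Lemma tensor_ind (P : tensor -> Prop) :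
  (forall v w, P (tpure v w)) -> (forall s t, P s -> P t -> P (s + t)) ->
  (forall c t, P t -> P (c *: t)) -> forall t, P t.
Proof.
move=> Pp PD PZ t; case: (tensor_piP t) => x ->.
elim: x => [v w|x Px y Py|c x Px]; first exact: Pp.
- by rewrite pi_tensorD; exact: PD.
- by rewrite pi_tensorZ; exact: PZ.
Qed.

(* The linear map V ⊗ W -> P induced by f (meaningful for bilinear f).       *)
Fixpoint texp_lift (P : lmodType K) (f : V -> W -> P) (x : texp) : P :=
  match x with
  | TPure v w => f v w
  | TAdd x y => texp_lift f x + texp_lift f y
  | TScale c x => c *: texp_lift f x
  end.

Definition tlift (P : lmodType K) (f : V -> W -> P) (t : tensor) : P :=
  texp_lift f (repr t).

Section Lift.
Variables (P : lmodType K) (f : V -> W -> P).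
Hypothesis fb : bilinear_for *:%R *:%R f.

Lemma texp_lift_teq x y : teq x y -> texp_lift f x = texp_lift f y.
Proof.
have [fl fr] := fb.
have fDl v v' w : f (v + v') w = f v w + f v' w.
  by have /= := fl w 1 v v'; rewrite !scale1r.
have fDr v w w' : f v (w + w') = f v w + f v w'.
  by have /= := fr v 1 w w'; rewrite !scale1r.
have f0l w : f 0 w = 0.
  by have /= := fDl 0 0 w; rewrite addr0 => /(canLR (addrK _)); rewrite subrr.
have f0r v : f v 0 = 0.
  by have /= := fDr v 0 0; rewrite addr0 => /(canLR (addrK _)); rewrite subrr.
have fZl c v w : f (c *: v) w = c *: f v w.
  by have /= := fl w c v 0; rewrite !addr0 f0l addr0.
have fZr c v w : f v (c *: w) = c *: f v w.
  by have /= := fr v c w 0; rewrite !addr0 f0r addr0.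
elim=> //=.
- by move=> {}y {}x z _ -> _ ->.
- by move=> {}x x' {}y y' _ -> _ ->.
- by move=> c {}x x' _ ->.
- by move=> *; rewrite addrA.
- by move=> *; rewrite addrC.
- by move=> {}x; rewrite f0l add0r.
- by move=> {}x; rewrite scaleN1r addNr f0l.
- by move=> *; rewrite scalerA.
- by move=> *; rewrite scale1r.
- by move=> *; rewrite scalerDr.
- by move=> *; rewrite scalerDl.
Qed.

Lemma tlift_pi x : tlift f (\pi_tensor x) = texp_lift f x.
Proof. exact/texp_lift_teq/teq_repr. Qed.

Lemma tlift_linear : linear (tlift f).
Proof.
move=> c s t; case: (tensor_piP s) (tensor_piP t) => x -> [y ->].
by rewrite -pi_tensorZ -pi_tensorD !tlift_pi.
Qed.

Lemma tlift_pure v w : tlift f (tpure v w) = f v w.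
Proof. exact: tlift_pi. Qed.

End Lift.

End Tensor.

Arguments tensor {K} (V W)%_type_scope.
Notation "V ⊗ W" := (tensor V W) : type_scope.
Notation "v ⊗ w" := (tpure v w) : ring_scope.

Section TensorMaps.
Variable K : fieldType.
Implicit Types U V W : lmodType K.

Lemma tpureDl V W (v v' : V) (w : W) : (v + v') ⊗ w = v ⊗ w + v' ⊗ w.
Proof. by have /= := (tpure_bilinear V W).1 w 1 v v'; rewrite !scale1r. Qed.
Lemma tpureDr V W (v : V) (w w' : W) : v ⊗ (w + w') = v ⊗ w + v ⊗ w'.
Proof. by have /= := (tpure_bilinear V W).2 v 1 w w'; rewrite !scale1r. Qed.
Lemma tpureZl V W c (v : V) (w : W) : (c *: v) ⊗ w = c *: (v ⊗ w).
Proof. by rewrite -pi_tensorZ; exact/tensor_eqP/teq_pureZl. Qed.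
Lemma tpureZr V W c (v : V) (w : W) : v ⊗ (c *: w) = c *: (v ⊗ w).
Proof. by rewrite -pi_tensorZ; exact/tensor_eqP/teq_pureZr. Qed.

Lemma linear_tensor_ext V W (P : lmodType K) (f g : {linear (V ⊗ W)%type -> P}) :
  (forall v w, f (v ⊗ w) = g (v ⊗ w)) -> f =1 g.
Proof.
move=> fg; apply: tensor_ind => // [s t Ps Pt|c t Pt].
  by rewrite !linearD /= Ps Pt.
by rewrite !linearZ /= Pt.
Qed.

(* f ⊗ g *)
Section Map.
Variables (V V' W W' : lmodType K).
Variables (f : {linear V -> V'}) (g : {linear W -> W'}).

Definition tmap : V ⊗ W -> V' ⊗ W' := tlift (fun v w => f v ⊗ g w).

Lemma tmap_bilinear : bilinear_for *:%R *:%R (fun v w => f v ⊗ g w).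
Proof.
by split=> [w c v v'|v c w w'] /=; rewrite linearP (tpureDl, tpureDr)
  (tpureZl, tpureZr).
Qed.

HB.instance Definition _ := GRing.isLinear.Build K (V ⊗ W)%type (V' ⊗ W')%type _ tmap
  (tlift_linear tmap_bilinear).

Lemma tmapE v w : tmap (v ⊗ w) = f v ⊗ g w.
Proof. exact: (tlift_pure tmap_bilinear). Qed.
End Map.

Section Assoc.
Variables (U V W : lmodType K).

Definition tassoc : (U ⊗ V) ⊗ W -> U ⊗ (V ⊗ W) :=
  tlift (fun t w => tlift (fun u v => u ⊗ (v ⊗ w)) t).

Lemma tassoc_bilinear1 w :
  bilinear_for *:%R *:%R (fun (u : U) (v : V) => u ⊗ (v ⊗ w : V ⊗ W)).
Proof.
by split=> [v c u u'|u c v v'] /=; rewrite !(tpureDl, tpureZl, tpureDr, tpureZr).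
Qed.

Lemma tassoc_bilinear : bilinear_for *:%R *:%R
  (fun (t : U ⊗ V) (w : W) => tlift (fun u v => u ⊗ (v ⊗ w)) t).
Proof.
split=> [w c s t|t c w w'] /=; first exact: (tlift_linear (tassoc_bilinear1 w)).
have L w0 := tlift_linear (tassoc_bilinear1 w0).
elim/tensor_ind: t => [u v|s t Ps Pt|a t Pt].
- rewrite !tlift_pure; do ?exact: tassoc_bilinear1.
  by rewrite !(tpureDr, tpureZr).
- have E (w0 : W) : tlift (fun u v => u ⊗ (v ⊗ w0)) (s + t) =
     tlift (fun u v => u ⊗ (v ⊗ w0)) s + tlift (fun u v => u ⊗ (v ⊗ w0)) t.
    by have := L w0 1 s t; rewrite !scale1r.
  by rewrite !E Ps Pt scalerDr addrACA.
- have E0 (w0 : W) : tlift (fun u v => u ⊗ (v ⊗ w0)) (0 : U ⊗ V) = 0.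
    have := L w0 1 0 0; rewrite !scale1r addr0 => /(canLR (addrK _)).
    by rewrite subrr.
  have E (w0 : W) : tlift (fun u v => u ⊗ (v ⊗ w0)) (a *: t) =
     a *: tlift (fun u v => u ⊗ (v ⊗ w0)) t.
    by have := L w0 a t 0; rewrite !addr0 E0 addr0.
  by rewrite !E Pt scalerDr !scalerA mulrC.
Qed.

HB.instance Definition _ := GRing.isLinear.Build K ((U ⊗ V) ⊗ W)%type (U ⊗ (V ⊗ W))%type
  _ tassoc (tlift_linear tassoc_bilinear).

Lemma tassocE u v w : tassoc ((u ⊗ v) ⊗ w) = u ⊗ (v ⊗ w).
Proof.
by rewrite /tassoc !tlift_pure //; [exact: tassoc_bilinear1|exact: tassoc_bilinear].
Qed.
End Assoc.

Section AssocInv.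
Variables (U V W : lmodType K).

Definition tassocV : U ⊗ (V ⊗ W) -> (U ⊗ V) ⊗ W :=
  tlift (fun u t => tlift (fun v w => (u ⊗ v) ⊗ w) t).

Lemma tassocV_bilinear1 u :
  bilinear_for *:%R *:%R (fun (v : V) (w : W) => (u ⊗ v : U ⊗ V) ⊗ w).
Proof.
by split=> [w c v v'|v c w w'] /=; rewrite !(tpureDl, tpureZl, tpureDr, tpureZr).
Qed.

Lemma tassocV_bilinear : bilinear_for *:%R *:%R
  (fun (u : U) (t : V ⊗ W) => tlift (fun v w => (u ⊗ v) ⊗ w) t).
Proof.
split=> [t c u u'|u c s t] /=; last exact: (tlift_linear (tassocV_bilinear1 u)).
have L w0 := tlift_linear (tassocV_bilinear1 w0).
elim/tensor_ind: t => [v w|s t Ps Pt|a t Pt].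
- rewrite !tlift_pure; do ?exact: tassocV_bilinear1.
  by rewrite !(tpureDr, tpureZr, tpureDl, tpureZl).
- have E (u0 : U) : tlift (fun v w => (u0 ⊗ v) ⊗ w) (s + t) =
     tlift (fun v w => (u0 ⊗ v) ⊗ w) s + tlift (fun v w => (u0 ⊗ v) ⊗ w) t.
    by have := L u0 1 s t; rewrite !scale1r.
  by rewrite !E Ps Pt scalerDr addrACA.
- have E0 (u0 : U) : tlift (fun v w => (u0 ⊗ v) ⊗ w) (0 : V ⊗ W) = 0.
    have := L u0 1 0 0; rewrite !scale1r addr0 => /(canLR (addrK _)).
    by rewrite subrr.
  have E (u0 : U) : tlift (fun v w => (u0 ⊗ v) ⊗ w) (a *: t) =
     a *: tlift (fun v w => (u0 ⊗ v) ⊗ w) t.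
    by have := L u0 a t 0; rewrite !addr0 E0 addr0.
  by rewrite !E Pt scalerDr !scalerA mulrC.
Qed.

HB.instance Definition _ := GRing.isLinear.Build K (U ⊗ (V ⊗ W))%type ((U ⊗ V) ⊗ W)%type
  _ tassocV (tlift_linear tassocV_bilinear).

Lemma tassocVE u v w : tassocV (u ⊗ (v ⊗ w)) = (u ⊗ v) ⊗ w.
Proof.
by rewrite /tassocV !tlift_pure //; [exact: tassocV_bilinear1|exact: tassocV_bilinear].
Qed.
End AssocInv.

(* μ *)
Section Mul.
Variable A : algType K.

Definition tmul : A ⊗ A -> A := tlift *%R.

Lemma tmul_bilinear : bilinear_for *:%R *:%R (@GRing.mul A).
Proof.
split=> [y c x x'|x c y y'] /=; first by rewrite mulrDl scalerAl.
by rewrite mulrDr scalerAr.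
Qed.

HB.instance Definition _ := GRing.isLinear.Build K (A ⊗ A)%type A
  _ tmul (tlift_linear tmul_bilinear).

Lemma tmulE x y : tmul (x ⊗ y) = x * y.
Proof. exact: (tlift_pure tmul_bilinear). Qed.
End Mul.

End TensorMaps.

(* GDQ rings with unit.  The maps ∂ ⊗ id and id ⊗ ∂ land in (A ⊗ A) ⊗ A and   *)
(* A ⊗ (A ⊗ A), which the axioms identify through [tassoc] and [tassocV].     *)
Record gdqRing (K : fieldType) := GDQRing {
  gdq_alg :> algType K;
  gdq_diff : {linear gdq_alg -> (gdq_alg ⊗ gdq_alg)%type};
  gdq_coassoc : forall a,
    tassoc (tmap gdq_diff idfun (gdq_diff a)) =
    tmap idfun gdq_diff (gdq_diff a);
  gdq_derivation : forall t,
    gdq_diff (tmul t) =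
    tmap idfun (@tmul K gdq_alg) (tassoc (tmap gdq_diff idfun t)) +
    tmap (@tmul K gdq_alg) idfun (tassocV (tmap idfun gdq_diff t))
}.

Arguments gdq_diff {K} _.
Notation "∂[ A ]" := (gdq_diff A) (at level 0, format "∂[ A ]") : ring_scope.

Definition gdq_hom (K : fieldType) (A1 A2 : gdqRing K)
    (f : {linear A1 -> A2}) : Prop :=
  {morph f : x y / x * y} /\ forall a, tmap f f (∂[A1] a) = ∂[A2] (f a).

Section GdqTheory.
Variables (K : fieldType) (A : gdqRing K).

Lemma gdq_diffM (x y : A) :
  ∂[A] (x * y) = tmap idfun (@tmul K A) (tassoc (∂[A] x ⊗ y)) +
                 tmap (@tmul K A) idfun (tassocV (x ⊗ ∂[A] y)).
Proof. by rewrite -(tmulE x y) gdq_derivation !tmapE. Qed.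

Lemma gdq_diff1 : ∂[A] 1 = 0.
Proof.
have idl (t : A ⊗ A) : tmap idfun (@tmul K A) (tassoc (t ⊗ 1)) = t.
  elim/tensor_ind: t => [x y|s t Ps Pt|c t Pt].
  - by rewrite tassocE tmapE /= tmulE mulr1.
  - by rewrite tpureDl !linearD /= Ps Pt.
  - by rewrite tpureZl !linearZ /= Pt.
have idr (t : A ⊗ A) : tmap (@tmul K A) idfun (tassocV (1 ⊗ t)) = t.
  elim/tensor_ind: t => [x y|s t Ps Pt|c t Pt].
  - by rewrite tassocVE tmapE /= tmulE mul1r.
  - by rewrite tpureDr !linearD /= Ps Pt.
  - by rewrite tpureZr !linearZ /= Pt.
have := gdq_diffM 1 1; rewrite mulr1 idl idr => /(canLR (addrK _)).
by rewrite subrr.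
Qed.

Definition gdq_ker_pred : {pred A} := fun a => ∂[A] a == 0.

Lemma gdq_ker_closed : GRing.subsemialg_closed gdq_ker_pred.
Proof.
apply: GRing.subalg_closed_semi; split=> [|c x y|x y]; rewrite !unfold_in.
- by rewrite gdq_diff1.
- by move=> /eqP dx /eqP dy; rewrite linearP dx dy scaler0 addr0.
- move=> /eqP dx /eqP dy; rewrite gdq_diffM dx dy.
  by rewrite -(scale0r 0) tpureZl tpureZr !scale0r !linear0 addr0.
Qed.

(* Ker ∂, as a unital algebra *)
Record gdq_ker : Type := GdqKer {
  gdq_ker_val :> A;
  gdq_kerP : gdq_ker_val \in gdq_ker_pred
}.

HB.instance Definition _ := [isSub for gdq_ker_val].
HB.instance Definition _ := [Choice of gdq_ker by <:].
HB.instance Definition _ :=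
  GRing.SubChoice_isSubAlgebra.Build K A gdq_ker_pred gdq_ker gdq_ker_closed.

Lemma gdq_ker_val_linear : linear gdq_ker_val.
Proof. by []. Qed.
Lemma gdq_ker_val_monoid_morphism : monoid_morphism gdq_ker_val.
Proof. by []. Qed.

HB.instance Definition _ :=
  GRing.isLinear.Build K gdq_ker A _ gdq_ker_val gdq_ker_val_linear.
HB.instance Definition _ :=
  GRing.isMonoidMorphism.Build gdq_ker A gdq_ker_val
    gdq_ker_val_monoid_morphism.

End GdqTheory.

Section NCPoly.
Variables (K : fieldType) (N : algType K).

(* N<X>, the K-algebra freely generated by the unital K-algebra N and one    *)
(* further element X (the free product of N and K[X]): formal expressions in  *)
(* X and constants of N, modulo the smallest congruence that contains the     *)
(* axioms of unital K-algebras and makes N -> N<X> a unital homomorphism.     *)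
Inductive nexp : Type :=
  | NConst of N
  | NVar
  | NAdd of nexp & nexp
  | NMul of nexp & nexp
  | NScale of K & nexp.

Inductive neq : nexp -> nexp -> Prop :=
  | neq_refl x : neq x x
  | neq_sym x y : neq x y -> neq y x
  | neq_trans y x z : neq x y -> neq y z -> neq x z
  | neq_add x x' y y' : neq x x' -> neq y y' -> neq (NAdd x y) (NAdd x' y')
  | neq_mul x x' y y' : neq x x' -> neq y y' -> neq (NMul x y) (NMul x' y')
  | neq_scale c x x' : neq x x' -> neq (NScale c x) (NScale c x')
  | neq_addA x y z : neq (NAdd x (NAdd y z)) (NAdd (NAdd x y) z)
  | neq_addC x y : neq (NAdd x y) (NAdd y x)
  | neq_add0 x : neq (NAdd (NConst 0) x) x
  | neq_addN x : neq (NAdd (NScale (-1) x) x) (NConst 0)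
  | neq_scaleA a b x : neq (NScale a (NScale b x)) (NScale (a * b) x)
  | neq_scale1 x : neq (NScale 1 x) x
  | neq_scaleDr a x y :
      neq (NScale a (NAdd x y)) (NAdd (NScale a x) (NScale a y))
  | neq_scaleDl a b x : neq (NScale (a + b) x) (NAdd (NScale a x) (NScale b x))
  | neq_mulA x y z : neq (NMul x (NMul y z)) (NMul (NMul x y) z)
  | neq_mul1l x : neq (NMul (NConst 1) x) x
  | neq_mul1r x : neq (NMul x (NConst 1)) x
  | neq_mulDl x y z : neq (NMul (NAdd x y) z) (NAdd (NMul x z) (NMul y z))
  | neq_mulDr x y z : neq (NMul x (NAdd y z)) (NAdd (NMul x y) (NMul x z))
  | neq_scaleAl a x y : neq (NScale a (NMul x y)) (NMul (NScale a x) y)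
  | neq_scaleAr a x y : neq (NScale a (NMul x y)) (NMul x (NScale a y))
  | neq_constD m n : neq (NConst (m + n)) (NAdd (NConst m) (NConst n))
  | neq_constM m n : neq (NConst (m * n)) (NMul (NConst m) (NConst n))
  | neq_constZ c n : neq (NConst (c *: n)) (NScale c (NConst n)).

HB.instance Definition _ := gen_eqMixin nexp.
HB.instance Definition _ := gen_choiceMixin nexp.

Definition neqb (x y : nexp) : bool := `[< neq x y >].

Lemma neqb_equiv : equiv_class_of neqb.
Proof.
split=> [x|x y|y x z].
- exact/asboolP/neq_refl.
- by apply/asboolP/asboolP; exact: neq_sym.
- by move=> /asboolP xy /asboolP yz; apply/asboolP; exact: (neq_trans xy yz).
Qed.

Canonical neqb_equiv_rel := EquivRelPack neqb_equiv.

Definition ncpoly : Type := {eq_quot neqb}.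
HB.instance Definition _ := Choice.on ncpoly.
HB.instance Definition _ := Quotient.on ncpoly.

Lemma ncpoly_eqP x y : neq x y <-> \pi_ncpoly x = \pi_ncpoly y.
Proof. by split=> [xy|/eqmodP/asboolP//]; apply/eqmodP/asboolP. Qed.

Definition ncC (n : N) : ncpoly := \pi_ncpoly (NConst n).
Definition ncX : ncpoly := \pi_ncpoly NVar.
Definition ncpoly_add (p q : ncpoly) : ncpoly :=
  \pi_ncpoly (NAdd (repr p) (repr q)).
Definition ncpoly_mul (p q : ncpoly) : ncpoly :=
  \pi_ncpoly (NMul (repr p) (repr q)).
Definition ncpoly_scale (c : K) (p : ncpoly) : ncpoly :=
  \pi_ncpoly (NScale c (repr p)).

Lemma neq_repr x : neq (repr (\pi_ncpoly x)) x.
Proof. by apply/ncpoly_eqP; rewrite reprK. Qed.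

Lemma ncpoly_addE x y :
  ncpoly_add (\pi_ncpoly x) (\pi_ncpoly y) = \pi_ncpoly (NAdd x y).
Proof. by apply/ncpoly_eqP/neq_add; exact: neq_repr. Qed.

Lemma ncpoly_mulE x y :
  ncpoly_mul (\pi_ncpoly x) (\pi_ncpoly y) = \pi_ncpoly (NMul x y).
Proof. by apply/ncpoly_eqP/neq_mul; exact: neq_repr. Qed.

Lemma ncpoly_scaleE c x :
  ncpoly_scale c (\pi_ncpoly x) = \pi_ncpoly (NScale c x).
Proof. by apply/ncpoly_eqP/neq_scale; exact: neq_repr. Qed.

Lemma ncpoly_piP (p : ncpoly) : exists x, p = \pi_ncpoly x.
Proof. by exists (repr p); rewrite reprK. Qed.

Let piE := (ncpoly_addE, ncpoly_mulE, ncpoly_scaleE).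

Lemma ncpoly_addA : associative ncpoly_add.
Proof.
move=> p q r; case: (ncpoly_piP p) (ncpoly_piP q) (ncpoly_piP r).
by move=> x -> [y ->] [z ->]; rewrite !piE; exact/ncpoly_eqP/neq_addA.
Qed.

Lemma ncpoly_addC : commutative ncpoly_add.
Proof.
move=> p q; case: (ncpoly_piP p) (ncpoly_piP q) => x -> [y ->].
by rewrite !piE; exact/ncpoly_eqP/neq_addC.
Qed.

Lemma ncpoly_add0 : left_id (ncC 0) ncpoly_add.
Proof.
move=> p; case: (ncpoly_piP p) => x ->.
by rewrite piE; exact/ncpoly_eqP/neq_add0.
Qed.

Lemma ncpoly_addN : left_inverse (ncC 0) (ncpoly_scale (-1)) ncpoly_add.
Proof.
move=> p; case: (ncpoly_piP p) => x ->.
by rewrite !piE; exact/ncpoly_eqP/neq_addN.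
Qed.

HB.instance Definition _ := GRing.isZmodule.Build ncpoly
  ncpoly_addA ncpoly_addC ncpoly_add0 ncpoly_addN.

Lemma pi_ncpolyD x y : \pi_ncpoly (NAdd x y) = \pi_ncpoly x + \pi_ncpoly y.
Proof. by rewrite -ncpoly_addE. Qed.

Lemma ncpoly_scaleA a b p :
  ncpoly_scale a (ncpoly_scale b p) = ncpoly_scale (a * b) p.
Proof.
case: (ncpoly_piP p) => x ->; rewrite !piE.
exact/ncpoly_eqP/neq_scaleA.
Qed.

Lemma ncpoly_scale1 : left_id 1 ncpoly_scale.
Proof.
move=> p; case: (ncpoly_piP p) => x ->; rewrite !piE.
exact/ncpoly_eqP/neq_scale1.
Qed.

Lemma ncpoly_scaleDr : right_distributive ncpoly_scale +%R.
Proof.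
move=> a p q; case: (ncpoly_piP p) (ncpoly_piP q) => x -> [y ->].
rewrite -pi_ncpolyD !piE -pi_ncpolyD.
exact/ncpoly_eqP/neq_scaleDr.
Qed.

Lemma ncpoly_scaleDl p : {morph ncpoly_scale^~ p : a b / a + b}.
Proof.
move=> a b; case: (ncpoly_piP p) => x ->; rewrite !piE -pi_ncpolyD.
exact/ncpoly_eqP/neq_scaleDl.
Qed.

HB.instance Definition _ := GRing.Zmodule_isLmodule.Build K ncpoly
  ncpoly_scaleA ncpoly_scale1 ncpoly_scaleDr ncpoly_scaleDl.

Lemma ncpoly_mulA : associative ncpoly_mul.
Proof.
move=> p q r; case: (ncpoly_piP p) (ncpoly_piP q) (ncpoly_piP r).
by move=> x -> [y ->] [z ->]; rewrite !piE; exact/ncpoly_eqP/neq_mulA.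
Qed.

Lemma ncpoly_mul1l : left_id (ncC 1) ncpoly_mul.
Proof.
move=> p; case: (ncpoly_piP p) => x ->.
by rewrite piE; exact/ncpoly_eqP/neq_mul1l.
Qed.

Lemma ncpoly_mul1r : right_id (ncC 1) ncpoly_mul.
Proof.
move=> p; case: (ncpoly_piP p) => x ->.
by rewrite piE; exact/ncpoly_eqP/neq_mul1r.
Qed.

Lemma ncpoly_mulDl : left_distributive ncpoly_mul +%R.
Proof.
move=> p q r; case: (ncpoly_piP p) (ncpoly_piP q) (ncpoly_piP r).
move=> x -> [y ->] [z ->]; rewrite -pi_ncpolyD !piE -pi_ncpolyD.
exact/ncpoly_eqP/neq_mulDl.
Qed.

Lemma ncpoly_mulDr : right_distributive ncpoly_mul +%R.
Proof.
move=> p q r; case: (ncpoly_piP p) (ncpoly_piP q) (ncpoly_piP r).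
move=> x -> [y ->] [z ->]; rewrite -pi_ncpolyD !piE -pi_ncpolyD.
exact/ncpoly_eqP/neq_mulDr.
Qed.

Section Eval.
Variables (B : algType K) (f : {lrmorphism N -> B}) (b : B).

Fixpoint nexp_eval (x : nexp) : B :=
  match x with
  | NConst n => f n
  | NVar => b
  | NAdd x y => nexp_eval x + nexp_eval y
  | NMul x y => nexp_eval x * nexp_eval y
  | NScale c x => c *: nexp_eval x
  end.

Lemma nexp_eval_neq x y : neq x y -> nexp_eval x = nexp_eval y.
Proof.
elim=> //=.
- by move=> {}y {}x z _ -> _ ->.
- by move=> {}x x' {}y y' _ -> _ ->.
- by move=> {}x x' {}y y' _ -> _ ->.
- by move=> c {}x x' _ ->.
- by move=> *; rewrite addrA.
- by move=> *; rewrite addrC.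
- by move=> *; rewrite linear0 add0r.
- by move=> *; rewrite scaleN1r addNr linear0.
- by move=> *; rewrite scalerA.
- by move=> *; rewrite scale1r.
- by move=> *; rewrite scalerDr.
- by move=> *; rewrite scalerDl.
- by move=> *; rewrite mulrA.
- by move=> *; rewrite rmorph1 mul1r.
- by move=> *; rewrite rmorph1 mulr1.
- by move=> *; rewrite mulrDl.
- by move=> *; rewrite mulrDr.
- by move=> *; rewrite scalerAl.
- by move=> *; rewrite scalerAr.
- by move=> *; rewrite linearD.
- by move=> *; rewrite rmorphM.
- by move=> *; rewrite linearZ.
Qed.

(* the unital homomorphism N<X> -> B that is f on N and maps X to b *)
Definition nceval (p : ncpoly) : B := nexp_eval (repr p).

Lemma nceval_pi x : nceval (\pi_ncpoly x) = nexp_eval x.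
Proof. exact/nexp_eval_neq/neq_repr. Qed.

End Eval.

Lemma ncpoly_oner_neq0 : ncC 1 != ncC 0.
Proof.
apply/eqP => /(congr1 (nceval (idfun : {lrmorphism N -> N}) 0)).
by rewrite !nceval_pi /=; apply/eqP/oner_neq0.
Qed.

HB.instance Definition _ := GRing.Zmodule_isNzRing.Build ncpoly
  ncpoly_mulA ncpoly_mul1l ncpoly_mul1r ncpoly_mulDl ncpoly_mulDr
  ncpoly_oner_neq0.

Lemma ncpoly_scaleAl a (p q : ncpoly) : a *: (p * q) = (a *: p) * q.
Proof.
case: (ncpoly_piP p) (ncpoly_piP q) => x -> [y ->].
rewrite /*:%R /*%R /= !piE; exact/ncpoly_eqP/neq_scaleAl.
Qed.

HB.instance Definition _ :=
  GRing.Lmodule_isLalgebra.Build K ncpoly ncpoly_scaleAl.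

Lemma ncpoly_scaleAr a (p q : ncpoly) : a *: (p * q) = p * (a *: q).
Proof.
case: (ncpoly_piP p) (ncpoly_piP q) => x -> [y ->].
rewrite /*:%R /*%R /= !piE; exact/ncpoly_eqP/neq_scaleAr.
Qed.

HB.instance Definition _ :=
  GRing.Lalgebra_isAlgebra.Build K ncpoly ncpoly_scaleAr.

Lemma pi_ncpolyM x y : \pi_ncpoly (NMul x y) = \pi_ncpoly x * \pi_ncpoly y.
Proof. by rewrite -ncpoly_mulE. Qed.

Lemma pi_ncpolyZ c x : \pi_ncpoly (NScale c x) = c *: \pi_ncpoly x.
Proof. by rewrite -ncpoly_scaleE. Qed.

Lemma ncpoly_ind (P : ncpoly -> Prop) :
  (forall n, P (ncC n)) -> P ncX ->
  (forall p q, P p -> P q -> P (p + q)) ->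
  (forall p q, P p -> P q -> P (p * q)) ->
  forall p, P p.
Proof.
move=> PC PX PD PM p; case: (ncpoly_piP p) => x ->.
elim: x => [n||x Px y Py|x Px y Py|c x Px].
- exact: PC.
- exact: PX.
- by rewrite pi_ncpolyD; exact: PD.
- by rewrite pi_ncpolyM; exact: PM.
- rewrite pi_ncpolyZ -[\pi_ncpoly x]mul1r scalerAl; apply: PM Px.
  suff -> : c *: (1 : ncpoly) = ncC (c *: 1) by [].
  by rewrite -pi_ncpolyZ; apply/ncpoly_eqP/neq_sym/neq_constZ.
Qed.

Lemma ncC_linear : linear ncC.
Proof.
move=> c m n; rewrite -pi_ncpolyZ -pi_ncpolyD; apply/ncpoly_eqP.
apply: neq_trans (neq_constD _ _) _.
by apply: neq_add (neq_refl _); exact: neq_constZ.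
Qed.

HB.instance Definition _ := GRing.isLinear.Build K N ncpoly _ ncC ncC_linear.

Lemma ncC_monoid_morphism : monoid_morphism ncC.
Proof.
split=> // m n; rewrite -pi_ncpolyM.
exact/ncpoly_eqP/neq_constM.
Qed.

HB.instance Definition _ :=
  GRing.isMonoidMorphism.Build N ncpoly ncC ncC_monoid_morphism.

Section EvalMorphism.
Variables (B : algType K) (f : {lrmorphism N -> B}) (b : B).

Lemma nceval_linear : linear (nceval f b).
Proof.
move=> c p q; case: (ncpoly_piP p) (ncpoly_piP q) => x -> [y ->].
by rewrite -pi_ncpolyZ -pi_ncpolyD !nceval_pi.
Qed.

HB.instance Definition _ :=
  GRing.isLinear.Build K ncpoly B _ (nceval f b) nceval_linear.

Lemma nceval_monoid_morphism : monoid_morphism (nceval f b).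
Proof.
split=> [|p q]; first by rewrite nceval_pi /= rmorph1.
case: (ncpoly_piP p) (ncpoly_piP q) => x -> [y ->].
by rewrite -pi_ncpolyM !nceval_pi.
Qed.

HB.instance Definition _ :=
  GRing.isMonoidMorphism.Build ncpoly B (nceval f b) nceval_monoid_morphism.

Lemma ncevalC n : nceval f b (ncC n) = f n.
Proof. exact: nceval_pi. Qed.

Lemma ncevalX : nceval f b ncX = b.
Proof. exact: nceval_pi. Qed.

End EvalMorphism.

End NCPoly.

Section Bimodule.
Variables (K : fieldType) (A : algType K).

Definition lmulf (x y : A) : A := x * y.
Definition rmulf (x y : A) : A := y * x.

Lemma lmulf_linear x : linear (lmulf x).
Proof. by move=> c y z; rewrite /lmulf mulrDr scalerAr. Qed.
Lemma rmulf_linear x : linear (rmulf x).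
Proof. by move=> c y z; rewrite /rmulf mulrDl scalerAl. Qed.

HB.instance Definition _ x :=
  GRing.isLinear.Build K A A _ (lmulf x) (lmulf_linear x).
HB.instance Definition _ x :=
  GRing.isLinear.Build K A A _ (rmulf x) (rmulf_linear x).

Definition lact x : {linear (A ⊗ A)%type -> (A ⊗ A)%type} := tmap (lmulf x) idfun.
Definition ract x : {linear (A ⊗ A)%type -> (A ⊗ A)%type} := tmap idfun (rmulf x).

Lemma lactE x a b : lact x (a ⊗ b) = (x * a) ⊗ b.
Proof. by rewrite /lact /= tmapE. Qed.
Lemma ractE x a b : ract x (a ⊗ b) = a ⊗ (b * x).
Proof. by rewrite /ract /= tmapE. Qed.

Lemma lact_tmul x t : tmap (@tmul K A) idfun (tassocV (x ⊗ t)) = lact x t.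
Proof.
elim/tensor_ind: t => [a b|s t Ps Pt|c t Pt].
- by rewrite tassocVE tmapE /= tmulE lactE.
- by rewrite tpureDr !linearD /= Ps Pt.
- by rewrite tpureZr !linearZ /= Pt.
Qed.

Lemma ract_tmul x t : tmap idfun (@tmul K A) (tassoc (t ⊗ x)) = ract x t.
Proof.
elim/tensor_ind: t => [a b|s t Ps Pt|c t Pt].
- by rewrite tassocE tmapE /= tmulE ractE.
- by rewrite tpureDl !linearD /= Ps Pt.
- by rewrite tpureZl !linearZ /= Pt.
Qed.

Lemma lact1 t : lact 1 t = t.
Proof.
elim/tensor_ind: t => [a b|s t Ps Pt|c t Pt].
- by rewrite lactE mul1r.
- by rewrite linearD /= Ps Pt.
- by rewrite linearZ /= Pt.
Qed.

Lemma ract1 t : ract 1 t = t.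
Proof.
elim/tensor_ind: t => [a b|s t Ps Pt|c t Pt].
- by rewrite ractE mulr1.
- by rewrite linearD /= Ps Pt.
- by rewrite linearZ /= Pt.
Qed.

Lemma lactD x y t : lact (x + y) t = lact x t + lact y t.
Proof. by rewrite -!lact_tmul tpureDl !linearD. Qed.
Lemma ractD x y t : ract (x + y) t = ract x t + ract y t.
Proof. by rewrite -!ract_tmul tpureDr !linearD. Qed.
Lemma lactZ c x t : lact (c *: x) t = c *: lact x t.
Proof. by rewrite -!lact_tmul tpureZl !linearZ. Qed.
Lemma ractZ c x t : ract (c *: x) t = c *: ract x t.
Proof. by rewrite -!ract_tmul tpureZr !linearZ. Qed.

Lemma lactM x y t : lact (x * y) t = lact x (lact y t).
Proof.
elim/tensor_ind: t => [a b|s t Ps Pt|c t Pt].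
- by rewrite !lactE mulrA.
- by rewrite !linearD /= Ps Pt.
- by rewrite !linearZ /= Pt.
Qed.

Lemma ractM x y t : ract (x * y) t = ract y (ract x t).
Proof.
elim/tensor_ind: t => [a b|s t Ps Pt|c t Pt].
- by rewrite !ractE mulrA.
- by rewrite !linearD /= Ps Pt.
- by rewrite !linearZ /= Pt.
Qed.

Lemma lact_ract x y t : lact x (ract y t) = ract y (lact x t).
Proof.
elim/tensor_ind: t => [a b|s t Ps Pt|c t Pt].
- by rewrite !(ractE, lactE).
- by rewrite !linearD /= Ps Pt.
- by rewrite !linearZ /= Pt.
Qed.

End Bimodule.

Section NCPolyGdq.
Variables (K : fieldType) (N : algType K).
Local Notation P := (ncpoly N).

(* ∂_{X:N}: the derivation with ∂ X = 1 ⊗ 1 and ∂ n = 0 for n in N. *)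
Fixpoint nexp_diff (x : nexp N) : P ⊗ P :=
  match x with
  | NConst _ => 0
  | NVar => 1 ⊗ 1
  | NAdd x y => nexp_diff x + nexp_diff y
  | NMul x y => ract (\pi_P y) (nexp_diff x) + lact (\pi_P x) (nexp_diff y)
  | NScale c x => c *: nexp_diff x
  end.

Lemma nexp_diff_neq x y : neq x y -> nexp_diff x = nexp_diff y.
Proof.
elim=> //=.
- by move=> {}y {}x z _ -> _ ->.
- by move=> {}x x' {}y y' _ -> _ ->.
- by move=> {}x x' {}y y' /ncpoly_eqP -> -> /ncpoly_eqP -> ->.
- by move=> c {}x x' _ ->.
- by move=> *; rewrite addrA.
- by move=> *; rewrite addrC.
- by move=> *; rewrite add0r.
- by move=> *; rewrite scaleN1r addNr.
- by move=> *; rewrite scalerA.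
- by move=> *; rewrite scale1r.
- by move=> *; rewrite scalerDr.
- by move=> *; rewrite scalerDl.
- move=> {}x {}y z; rewrite !pi_ncpolyM ractM lactM !linearD /=.
  by rewrite lact_ract addrA.
- by move=> {}x; rewrite linear0 add0r; exact: lact1.
- by move=> {}x; rewrite linear0 addr0; exact: ract1.
- by move=> {}x {}y z; rewrite pi_ncpolyD lactD linearD /= addrACA.
- by move=> {}x {}y z; rewrite pi_ncpolyD ractD linearD /= addrACA.
- by move=> a {}x {}y; rewrite pi_ncpolyZ lactZ linearZ /= scalerDr.
- by move=> a {}x {}y; rewrite pi_ncpolyZ ractZ linearZ /= scalerDr.
- by rewrite addr0.
- by move=> *; rewrite !linear0 addr0.
- by move=> *; rewrite scaler0.
Qed.

Definition ncdiff (p : P) : P ⊗ P := nexp_diff (repr p).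

Lemma ncdiff_pi x : ncdiff (\pi_P x) = nexp_diff x.
Proof. exact/nexp_diff_neq/neq_repr. Qed.

Lemma ncdiff_linear : linear ncdiff.
Proof.
move=> c p q; case: (ncpoly_piP p) (ncpoly_piP q) => x -> [y ->].
by rewrite -pi_ncpolyZ -pi_ncpolyD !ncdiff_pi.
Qed.

HB.instance Definition _ := GRing.isLinear.Build K P (P ⊗ P)%type _
  ncdiff ncdiff_linear.

Lemma ncdiffC n : ncdiff (ncC n) = 0.
Proof. exact: ncdiff_pi. Qed.

Lemma ncdiffX : ncdiff (ncX N) = 1 ⊗ 1.
Proof. exact: ncdiff_pi. Qed.

Lemma ncdiffM p q : ncdiff (p * q) = ract q (ncdiff p) + lact p (ncdiff q).
Proof.
case: (ncpoly_piP p) (ncpoly_piP q) => x -> [y ->].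
by rewrite -pi_ncpolyM !ncdiff_pi.
Qed.

Lemma ncdiff_derivation t :
  ncdiff (tmul t) =
  tmap idfun (@tmul K P) (tassoc (tmap ncdiff idfun t)) +
  tmap (@tmul K P) idfun (tassocV (tmap idfun ncdiff t)).
Proof.
elim/tensor_ind: t => [p q|s t Ps Pt|c t Pt].
- by rewrite tmulE !tmapE /= ncdiffM ract_tmul lact_tmul.
- by rewrite !linearD /= Ps Pt /= addrACA.
- by rewrite !linearZ /= Pt /= scalerDr.
Qed.

Lemma ncdiff_coassoc p :
  tassoc (tmap ncdiff idfun (ncdiff p)) = tmap idfun ncdiff (ncdiff p).
Proof.
have d1 : ncdiff 1 = 0 := ncdiffC 1.
pose M (s t : P ⊗ P) : P ⊗ (P ⊗ P) :=
  tmap idfun (tmap (@tmul K P) idfun) (tmap idfun (@tassocV K P P P)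
    (tassoc (s ⊗ t))).
have ME a b a' b' : M (a ⊗ b) (a' ⊗ b') = a ⊗ ((b * a') ⊗ b').
  by rewrite /M tassocE !tmapE /= tassocVE tmapE /= tmulE.
have MDl s s' t : M (s + s') t = M s t + M s' t.
  by rewrite /M tpureDl !linearD.
have MZl c s t : M (c *: s) t = c *: M s t by rewrite /M tpureZl !linearZ.
have MDr s t t' : M s (t + t') = M s t + M s t'.
  by rewrite /M tpureDr !linearD.
have MZr c s t : M s (c *: t) = c *: M s t by rewrite /M tpureZr !linearZ.
have E1 x t : tassoc (tmap ncdiff idfun (lact x t)) =
    tmap (lmulf x) idfun (tassoc (tmap ncdiff idfun t)) + M (ncdiff x) t.
  elim/tensor_ind: t => [a b|s t Ps Pt|c t Pt].
  - rewrite lactE !tmapE /= ncdiffM tpureDl linearD /= addrC; congr (_ + _).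
      elim/tensor_ind: (ncdiff a) => [u v|s t Ps Pt|c t Pt].
      - by rewrite lactE !tassocE tmapE.
      - by rewrite !(linearD, tpureDl) /= Ps Pt.
      - by rewrite !(linearZ, tpureZl) /= Pt.
    elim/tensor_ind: (ncdiff x) => [u v|s t Ps Pt|c t Pt].
    - by rewrite ractE tassocE ME.
    - by rewrite MDl !(linearD, tpureDl) /= Ps Pt.
    - by rewrite MZl !(linearZ, tpureZl) /= Pt.
  - by rewrite MDr !linearD /= Ps Pt addrACA.
  - by rewrite MZr !linearZ /= Pt scalerDr.
have E2 x t : tassoc (tmap ncdiff idfun (ract x t)) =
    tmap idfun (tmap idfun (rmulf x)) (tassoc (tmap ncdiff idfun t)).
  elim/tensor_ind: t => [a b|s t Ps Pt|c t Pt].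
  - rewrite ractE !tmapE /=.
    elim/tensor_ind: (ncdiff a) => [u v|s t Ps Pt|c t Pt].
    - by rewrite !tassocE tmapE /= tmapE.
    - by rewrite !(linearD, tpureDl) /= Ps Pt.
    - by rewrite !(linearZ, tpureZl) /= Pt.
  - by rewrite !linearD /= Ps Pt.
  - by rewrite !linearZ /= Pt.
have E3 x t : tmap idfun ncdiff (ract x t) =
    tmap idfun (tmap idfun (rmulf x)) (tmap idfun ncdiff t) + M t (ncdiff x).
  elim/tensor_ind: t => [a b|s t Ps Pt|c t Pt].
  - rewrite ractE !tmapE /= ncdiffM tpureDr; congr (_ + _).
    elim/tensor_ind: (ncdiff x) => [u v|s t Ps Pt|c t Pt].
    - by rewrite lactE ME.
    - by rewrite MDr !(linearD, tpureDr) /= Ps Pt.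
    - by rewrite MZr !(linearZ, tpureZr) /= Pt.
  - by rewrite MDl !linearD /= Ps Pt addrACA.
  - by rewrite MZl !linearZ /= Pt scalerDr.
have E4 x t : tmap idfun ncdiff (lact x t) =
    tmap (lmulf x) idfun (tmap idfun ncdiff t).
  elim/tensor_ind: t => [a b|s t Ps Pt|c t Pt].
  - by rewrite lactE !tmapE.
  - by rewrite !linearD /= Ps Pt.
  - by rewrite !linearZ /= Pt.
elim/ncpoly_ind: p => [n||p q Pp Pq|p q Pp Pq].
- by rewrite ncdiffC !linear0.
- by rewrite ncdiffX !tmapE /= d1 -(scale0r 0) tpureZl tpureZr !scale0r linear0.
- by rewrite !linearD /= Pp Pq.
- rewrite ncdiffM !linearD /= E1 E2 E3 E4 Pp Pq.
  by rewrite -!addrA; congr (_ + _); rewrite addrC.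
Qed.

(* (N<X>, μ, ∂_{X:N}) *)
Definition ncpoly_gdq : gdqRing K :=
  GDQRing ncdiff_coassoc ncdiff_derivation.

End NCPolyGdq.

(* ψ : N<X> -> A, the inclusion on N = Ker ∂ and X |-> x *)
Definition gdq_psi (K : fieldType) (A : gdqRing K) (x : A) :
    {lrmorphism ncpoly (gdq_ker A) -> A} :=
  nceval (@gdq_ker_val K A) x.

(* Main.v *)
(* Iterating ∂ on the left factor gives D_k : A -> A^{⊗(k+1)}.  By the Leibniz
   rule and ∂X = 1 ⊗ 1, D_k maps n0 X n1 X ... X nk to n0 ⊗ n1 ⊗ ... ⊗ nk and
   kills the monomials with fewer than k occurrences of X.  So if ψ(p) = 0 and p
   has degree at most d, then D_d sends the degree-d part of p, a priori only
   the image of some t in N^{⊗(d+1)}, to t; since N^{⊗(d+1)} -> A^{⊗(d+1)} is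
   injective over a field, t = 0, and p has smaller degree. *)
From HB Require Import structures.
Require Import Defs.
From mathcomp Require Import all_boot all_order all_algebra.
From mathcomp Require Import boolp classical_sets.
From mathcomp Require Import reals complex.

Set Implicit Arguments.
Unset Strict Implicit.
Unset Printing Implicit Defensive.

Import GRing.Theory.
Local Open Scope ring_scope.

(** * Linear retractions and injectivity of tensor products of maps *)

Section Retraction.
Variables (K : fieldType) (V W : lmodType K) (f : {linear V -> W}).

(* A linear relation W ~> V agreeing with f^-1 on the image of f; the empty
   relation qualifies, so that empty chains need no special treatment. *)
Let partial_inverse (G : set (W * V)) : Prop :=
  (forall c p q, G p -> G q -> G (c *: p + q)) /\
  (forall p u, G p -> p.1 = f u -> p.2 = u).

Let inverse_span (G : set (W * V)) (w : W * V) : set (W * V) :=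
  fun r => exists p c, G p /\ r = p + c *: w.

(** Zorn's lemma yields a maximal linear relation agreeing with the inverse of [f]; maximality makes
    it total and forces it to contain every pair [(f u, u)]. *)
Lemma linear_inj_retraction :
  injective f -> exists g : {linear W -> V}, cancel f g.
Proof.
move=> f_inj.
have [] := @Zorn_bigcup _ partial_inverse.
  move=> F PF chainF; split.
    move=> c p q [G FG Gp] [H FH Hq].
    have [GH|HG] := chainF _ _ FG FH.
      by exists H => //; apply: (PF _ FH).1 => //; exact: GH.
    by exists G => //; apply: (PF _ FG).1 => //; exact: HG.
  by move=> p u [G FG Gp]; exact: (PF _ FG).2.
move=> G [[Glin Gf] Gmax].
have maxE H : partial_inverse H -> (forall p, G p -> H p) -> forall p, H p -> G p.
  move=> PH GH p Hp; apply: contrapT => nGp.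
  by apply: (Gmax H) => //; split=> // /(_ p Hp).
(* A maximal relation cannot be empty, since adjoining [0] keeps it admissible. *)
have G0 : G 0.
  apply: (maxE (fun p => G p \/ p = 0)); [|by left|by right].
  split=> [c p q [Gp|->] [Gq|->]|p u [|->]].
  - by left; exact: Glin.
  - left; rewrite addr0; have := Glin (c - 1) p p Gp Gp.
    by rewrite scalerBl scale1r subrK.
  - by left; rewrite scaler0 add0r.
  - by right; rewrite scaler0 add0r.
  - exact: Gf.
  - by rewrite /= -(linear0 f) => /f_inj.
have extend w : (forall p, inverse_span G w p -> forall u, p.1 = f u -> p.2 = u) ->
    G w.
  move=> Hf; apply: (maxE (inverse_span G w)).
  - split=> [c _ _ [p [a [Gp ->]]] [q [b [Gq ->]]]|p u Hp]; last exact: Hf.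
    exists (c *: p + q), (c * a + b); split; first exact: Glin.
    by rewrite scalerDr scalerDl scalerA addrACA.
  - by move=> p Gp; exists p, 0; rewrite scale0r addr0.
  - by exists 0, 1; rewrite scale1r add0r.
have Gfu u : G (f u, u).
  apply: extend => _ [p [c [Gp ->]]] v /= pE.
  have /(Gf _ _ Gp) -> : p.1 = f (v - c *: u).
    by rewrite linearB linearZ /= -pE addrK.
  by rewrite subrK.
have Gtot x : exists v, G (x, v).
  apply: contrapT => Gx; apply: (Gx); exists 0; apply: extend.
  move=> _ [p [c [Gp ->]]] u /=; rewrite scaler0 addr0.
  have [->|c0] := eqVneq c 0; first by rewrite scale0r addr0; exact: Gf.
  (* As [c] is invertible, solving [p.1 + c *: x = f u] for [x] relates [x] to this vector after
     all. *)
  move=> pE; exfalso; apply: Gx; exists (c^-1 *: (u - p.2)).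
  have -> : (x, c^-1 *: (u - p.2)) = c^-1 *: (-1 *: p + (f u, u)) + 0.
    rewrite addr0 -pE scaleN1r; congr pair => /=; last by rewrite addrC.
    by rewrite addKr scalerA mulVf// scale1r.
  by apply: (Glin) => //; exact: Glin.
have [g Gg] := choice Gtot.
have glin : linear g.
  (* Two values at the same point differ by a value at [0 = f 0], hence by [0]. *)
  move=> c x y; have := Glin (-1) _ _ (Glin c _ _ (Gg x) (Gg y)) (Gg (c *: x + y)).
  move=> /Gf /= /(_ 0); rewrite linear0 !scaleN1r addNr => /(_ erefl).
  by rewrite [- _ + _]addrC => /subr0_eq.
pose gL := HB.pack_for {linear W -> V} g (GRing.isLinear.Build K W V _ g glin).
by exists gL => u; exact: (Gf _ _ (Gg (f u))).
Qed.

End Retraction.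

(** The tensor product of retractions of [f] and [g] is a retraction of [tmap f g]. *)
Lemma tmap_inj (K : fieldType) (V V' W W' : lmodType K)
    (f : {linear V -> V'}) (g : {linear W -> W'}) :
  injective f -> injective g -> injective (tmap f g).
Proof.
move=> /linear_inj_retraction[f' fK] /linear_inj_retraction[g' gK].
apply: (can_inj (g := tmap f' g')) => t.
elim/tensor_ind: t => [v w|s t Ps Pt|c t Pt].
- by rewrite !tmapE fK gK.
- by rewrite !linearD /= Ps Pt.
- by rewrite !linearZ /= Pt.
Qed.

Section TensorPowers.
Variable K : fieldType.

(* [tpow V k] is the (k+1)-fold tensor power of V. *)
Fixpoint tpow (V : lmodType K) k : lmodType K :=
  if k is k'.+1 then (tpow V k' ⊗ V)%type else V.

Fixpoint tpow_map (V W : lmodType K) (f : {linear V -> W}) k :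
    {linear tpow V k -> tpow W k} :=
  match k return {linear tpow V k -> tpow W k} with
  | 0 => f
  | k'.+1 => tmap (tpow_map f k') f
  end.

Lemma tpow_map_inj (V W : lmodType K) (f : {linear V -> W}) k :
  injective f -> injective (tpow_map f k).
Proof. by move=> f_inj; elim: k => //= k IH; exact: tmap_inj. Qed.

End TensorPowers.

(** * The degree filtration of noncommutative polynomials *)

Section Monomials.
Variables (K : fieldType) (N : algType K).
Local Notation P := (ncpoly N).

(* [ncmon k] sends [n0 ⊗ n1 ⊗ ... ⊗ nk] to [n0 X n1 X ... X nk]. *)
Fixpoint ncmon k : {linear tpow N k -> P} :=
  match k return {linear tpow N k -> P} with
  | 0 => @ncC K N
  | k'.+1 => @tmul K P \o tmap (rmulf (ncX N) \o ncmon k') (@ncC K N)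
  end.

Lemma ncmonS k (t : tpow N k) n : ncmon k.+1 (t ⊗ n) = ncmon k t * ncX N * ncC n.
Proof. by rewrite /= tmapE tmulE. Qed.

(** Homogeneous components are peeled off from the top and only asserted to exist, because a
    quotient of expressions offers no normal form. *)
Fixpoint ncdeg_lt d (p : P) : Prop :=
  if d is d'.+1 then exists t, ncdeg_lt d' (p - ncmon d' t) else p = 0.

Lemma ncdeg_ltS d p : ncdeg_lt d p -> ncdeg_lt d.+1 p.
Proof. by move=> dp; exists 0; rewrite linear0 subr0. Qed.

Lemma ncdeg_lt_leq d e p : (d <= e)%N -> ncdeg_lt d p -> ncdeg_lt e p.
Proof.
move=> /subnK <-; elim: (e - d)%N => // k IH /IH; exact: ncdeg_ltS.
Qed.

Lemma ncdeg_ltD d p q : ncdeg_lt d p -> ncdeg_lt d q -> ncdeg_lt d (p + q).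
Proof.
elim: d p q => [|d IH] p q /=; first by move=> -> ->; rewrite addr0.
by move=> [s ps] [t qt]; exists (s + t); rewrite linearD opprD addrACA; exact: IH.
Qed.

Lemma ncmonMC k t n : exists t', ncmon k t * ncC n = ncmon k t'.
Proof.
case: k t => [t|k t]; first by exists (t * n); rewrite /= rmorphM.
(* The constant is absorbed into the last tensor factor. *)
exists (tmap idfun (rmulf n) t).
elim/tensor_ind: t => [s m|s t Ps Pt|c t Pt].
- by rewrite tmapE !ncmonS /rmulf rmorphM mulrA.
- by rewrite !linearD mulrDl Ps Pt.
- by rewrite !linearZ -scalerAl Pt.
Qed.

Lemma ncdeg_ltMC d p n : ncdeg_lt d p -> ncdeg_lt d (p * ncC n).
Proof.
elim: d p => [|d IH] p /=; first by move=> ->; rewrite mul0r.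
move=> [t /IH]; rewrite mulrBl; have [t' ->] := ncmonMC t n.
by exists t'.
Qed.

Lemma ncdeg_ltMX d p : ncdeg_lt d p -> ncdeg_lt d.+1 (p * ncX N).
Proof.
elim: d p => [|d IH] p.
  by move=> ->; rewrite mul0r; exact: ncdeg_ltS.
move=> [t /IH pt]; exists (t ⊗ 1).
by rewrite ncmonS rmorph1 mulr1 -mulrBl.
Qed.

Lemma ncdeg_lt_exists p : exists d, ncdeg_lt d p.
Proof.
(* Multiplying on the right of an arbitrary [q] reduces the product case of the induction to
   associativity. *)
suff H : forall q, (exists d, ncdeg_lt d q) -> exists d, ncdeg_lt d (q * p).
  by rewrite -[p]mul1r; apply: H; exists 1%N; exists 1; rewrite /= rmorph1 subrr.
elim/ncpoly_ind: p => [n||p1 p2 H1 H2|p1 p2 H1 H2] q qd.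
- by have [d ?] := qd; exists d; exact: ncdeg_ltMC.
- by have [d ?] := qd; exists d.+1; exact: ncdeg_ltMX.
- have [[d ?] [e ?]] := (H1 q qd, H2 q qd).
  exists (maxn d e); rewrite mulrDr; apply: ncdeg_ltD.
  + by apply: (@ncdeg_lt_leq d) => //; exact: leq_maxl.
  + by apply: (@ncdeg_lt_leq e) => //; exact: leq_maxr.
- by rewrite mulrA; apply: H2; exact: H1.
Qed.

End Monomials.

(** * Compatibility of ψ with the comultiplications *)

Section CanonicalMorphism.
Variables (K : fieldType) (A : gdqRing K) (X : A).
Hypothesis diffX : ∂[A] X = 1 ⊗ 1.
Local Notation N := (gdq_ker A).
Local Notation P := (ncpoly N).
Local Notation psi := (gdq_psi X).

Lemma gdq_diff_mul (x y : A) : ∂[A] (x * y) = ract y (∂[A] x) + lact x (∂[A] y).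
Proof. by rewrite gdq_diffM ract_tmul lact_tmul. Qed.

Lemma gdq_diff_ker (n : N) : ∂[A] (gdq_ker_val n) = 0.
Proof. by apply/eqP; exact: gdq_kerP. Qed.

Lemma gdq_psiC n : psi (ncC n) = gdq_ker_val n.
Proof. exact: ncevalC. Qed.

Lemma gdq_psiX : psi (ncX N) = X.
Proof. exact: ncevalX. Qed.

Lemma gdq_psiM p q : psi (p * q) = psi p * psi q.
Proof. exact: rmorphM. Qed.

Lemma gdq_psi_ncmonS k (t : tpow N k) n :
  psi (ncmon N k.+1 (t ⊗ n)) = psi (ncmon N k t) * X * gdq_ker_val n.
Proof. by rewrite ncmonS !gdq_psiM gdq_psiC gdq_psiX. Qed.

Lemma gdq_psi_ract q t : tmap psi psi (ract q t) = ract (psi q) (tmap psi psi t).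
Proof.
elim/tensor_ind: t => [a b|s t Ps Pt|c t Pt].
- by rewrite ractE !tmapE ractE rmorphM.
- by rewrite !linearD /= Ps Pt.
- by rewrite !linearZ /= Pt.
Qed.

Lemma gdq_psi_lact q t : tmap psi psi (lact q t) = lact (psi q) (tmap psi psi t).
Proof.
elim/tensor_ind: t => [a b|s t Ps Pt|c t Pt].
- by rewrite lactE !tmapE lactE rmorphM.
- by rewrite !linearD /= Ps Pt.
- by rewrite !linearZ /= Pt.
Qed.

(** Both sides obey the same Leibniz rule along [psi], so agreement on constants and on the
    indeterminate suffices. *)
Lemma gdq_psi_diff p : tmap psi psi (ncdiff p) = ∂[A] (psi p).
Proof.
elim/ncpoly_ind: p => [n||p q Pp Pq|p q Pp Pq].
- by rewrite ncdiffC linear0 gdq_psiC gdq_diff_ker.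
- by rewrite ncdiffX tmapE rmorph1 gdq_psiX diffX.
- by rewrite !linearD /= Pp Pq.
- by rewrite ncdiffM linearD /= gdq_psi_ract gdq_psi_lact Pp Pq rmorphM gdq_diff_mul.
Qed.

(** * Iterated comultiplication and injectivity of ψ *)

Fixpoint diff_iter k : {linear A -> tpow A k} :=
  match k return {linear A -> tpow A k} with
  | 0 => idfun
  | k'.+1 => tmap (diff_iter k') idfun \o ∂[A]
  end.

(** The last cut falls either inside [a], leaving [X * n] on the last factor, or at the displayed
    [X]; it never falls in [n], which [∂] kills. *)
Lemma diff_iter_mul k (a : A) (n : N) :
  diff_iter k.+1 (a * X * gdq_ker_val n) =
  tmap idfun (rmulf (X * gdq_ker_val n)) (diff_iter k.+1 a) +
  diff_iter k a ⊗ gdq_ker_val n.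
Proof.
rewrite /= -mulrA gdq_diff_mul gdq_diff_mul diffX gdq_diff_ker linear0 addr0.
rewrite ractE lactE mulr1 mul1r linearD /= tmapE; congr (_ + _).
elim/tensor_ind: (∂[A] a) => [u v|s t Ps Pt|c t Pt].
- by rewrite ractE !tmapE.
- by rewrite !linearD /= Ps Pt.
- by rewrite !linearZ /= Pt.
Qed.

Lemma diff_iter_ncmon_lt k l (t : tpow N k) :
  (k < l)%N -> diff_iter l (psi (ncmon N k t)) = 0.
Proof.
elim: k l t => [|k IH] [//|l] t kl.
  by rewrite /= gdq_psiC gdq_diff_ker linear0.
elim/tensor_ind: t => [s n|s t Ps Pt|c t Pt].
(* Induction kills both terms: the first is iterated [l.+1] times, the second [l] times, and
   [k < l]. *)
- rewrite gdq_psi_ncmonS diff_iter_mul !IH //.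
    by rewrite linear0 add0r -(scale0r 0) tpureZl scale0r.
  exact: ltnW.
- by rewrite !linearD Ps Pt addr0.
- by rewrite !linearZZ Pt scaler0.
Qed.

Lemma diff_iter_ncmon k (t : tpow N k) :
  diff_iter k (psi (ncmon N k t)) = tpow_map (@gdq_ker_val K A) k t.
Proof.
elim: k t => [|k IH] t; first by rewrite /= gdq_psiC.
elim/tensor_ind: t => [s n|s t Ps Pt|c t Pt].
- rewrite gdq_psi_ncmonS diff_iter_mul IH.
  (* The first term asks for [k.+1] cuts of a monomial of degree [k]; only the cut at the last [X]
     survives. *)
  by rewrite diff_iter_ncmon_lt // linear0 add0r /= tmapE.
- by rewrite !linearD Ps Pt.
- by rewrite !linearZ Pt.
Qed.

Lemma diff_iter_ncdeg_lt d l p :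
  (d <= l)%N -> ncdeg_lt d p -> diff_iter l (psi p) = 0.
Proof.
elim: d p => [|d IH] p dl /=; first by move=> ->; rewrite !linear0.
move=> [t /IH]; rewrite !linearB => /(_ (ltnW dl)).
by rewrite diff_iter_ncmon_lt // subr0.
Qed.

Lemma gdq_psi_inj : injective psi.
Proof.
apply: raddf_inj => p; have [d] := ncdeg_lt_exists p.
elim: d p => [//|d IH] p [t pt] psip.
have t0 : t = 0.
  apply: (@tpow_map_inj K N A (@gdq_ker_val K A) d val_inj).
  (* Since [psi p = 0], the remainder [p - ncmon d t] maps to minus the image of the top component,
     and [diff_iter d] kills it by degree. *)
  rewrite linear0 -diff_iter_ncmon; apply: oppr_inj.
  rewrite oppr0 -(diff_iter_ncdeg_lt (leqnn d) pt).
  by rewrite !linearB psip linear0 sub0r.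
by apply: IH => //; move: pt; rewrite t0 linear0 subr0.
Qed.

End CanonicalMorphism.

Theorem proposition4p5 (R : realType) (A : gdqRing R[i]) (X : A)
    (hX : ∂[A] X = 1 ⊗ 1) :
  injective (gdq_psi X) /\
  gdq_hom (A1 := ncpoly_gdq (gdq_ker A)) (A2 := A) (gdq_psi X).
Proof.
split; first exact: gdq_psi_inj.
split=> [x y|a]; first exact: rmorphM.
exact: gdq_psi_diff.
Qed.
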